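(* Let $(X,d)$ be a compact metric space containing at least two points and let $f:X\to X$ be a continuous map. If $f$ has shadowing and $f$ has mean ergodic shadowing, then $f$ is not minimal.
   Context: $\mathbb{N}$ denotes the set of non-negative integers. A set $E\subset\mathbb{N}$ has density zero if $\lim_{n\to\infty}\frac{1}{n}\#(E\cap\{0,1,\dots,n-1\})=0$. Shadowing: a sequence $\{x_i\}_{i\in\mathbb{N}}$ in $X$ is a $\delta$-pseudo orbit for $f$ if $d(f(x_i),x_{i+1})<\delta$ for all $i\in\mathbb{N}$; it is $\epsilon$-shadowed by $x\in X$ if $d(f^i(x),x_i)<\epsilon$ for all $i\in\mathbb{N}$. The map $f$ has shadowing if for every $\epsilon>0$ there is $\delta>0$ such that every $\delta$-pseudo orbit is $\epsilon$-shadowed by some point of $X$. Mean ergodic shadowing: a sequence $\{x_i\}_{i\in\mathbb{N}}$ in $X$ is a $\delta$-ergodic pseudo orbit for $f$ if the set $\{i\in\mathbb{N}: d(f(x_i),x_{i+1})\ge\delta\}$ has density zero. It is $\epsilon$-shadowed in average by $x\in X$ if $\limsup_{n\to\infty}\frac1n\sum_{i=0}^{n-1}d(f^i(x),x_i)<\epsilon$. The map $f$ has mean ergodic shadowing if for every $\epsilon>0$ there is $\delta>0$ such that every $\delta$-ergodic pseudo orbit is $\epsilon$-shadowed in average by some point of $X$. Minimality: a point $x\in X$ is syndetically recurrent if for every open neighborhood $U$ of $x$ the set $\{n\ge 1: f^n(x)\in U\}$ is syndetic (has bounded gaps). The map $f$ is minimal if $X=\overline{O_f(x)}$ for some syndetically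 recurrent point $x$, where $O_f(x)=\{f^n(x):n\ge 0\}$; equivalently, the orbit of every point is dense in $X$. *)

(* Defs.v *)
From mathcomp Require Import all_boot all_order all_algebra.
From mathcomp Require Import all_classical all_reals all_analysis.

Set Implicit Arguments.
Unset Strict Implicit.
Unset Printing Implicit Defensive.

Import Order.TTheory GRing.Theory Num.Theory.
Import numFieldNormedType.Exports.

Local Open Scope classical_set_scope.
Local Open Scope ring_scope.

(* The junk value at n = 0 does not affect the limit. *)
Definition density_zero (R : realType) (E : set nat) : Prop :=
  (#|[pred i : 'I_n | (i : nat) \in E]|%:R / n%:R : R) @[n --> \oo] --> (0 : R).

Definition syndetic (A : set nat) : Prop :=
  exists N : nat, forall n : nat, exists2 k : nat, A k & (n <= k <= n + N)%N.

Definition pseudo_orbit (R : realType) (X : metricType R) (f : X -> X)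
    (delta : R) (xs : nat -> X) : Prop :=
  forall i, mdist (f (xs i)) (xs i.+1) < delta.

Definition shadowed_by (R : realType) (X : metricType R) (f : X -> X)
    (eps : R) (xs : nat -> X) (x : X) : Prop :=
  forall i, mdist (iter i f x) (xs i) < eps.

Definition has_shadowing (R : realType) (X : metricType R) (f : X -> X) : Prop :=
  forall eps : R, 0 < eps -> exists2 delta : R, 0 < delta &
    forall xs, pseudo_orbit f delta xs -> exists x, shadowed_by f eps xs x.

Definition ergodic_pseudo_orbit (R : realType) (X : metricType R) (f : X -> X)
    (delta : R) (xs : nat -> X) : Prop :=
  density_zero R [set i | delta <= mdist (f (xs i)) (xs i.+1)].

(* The limsup is taken in \bar R, where it always exists; on unbounded spaces
   it may be +oo. *)
Definition shadowed_in_average_by (R : realType) (X : metricType R)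
    (f : X -> X) (eps : R) (xs : nat -> X) (x : X) : Prop :=
  (limn_esup (fun n =>
     (n%:R^-1 * \sum_(i < n) mdist (iter i f x) (xs i))%:E) < eps%:E)%E.

Definition has_mean_ergodic_shadowing (R : realType) (X : metricType R)
    (f : X -> X) : Prop :=
  forall eps : R, 0 < eps -> exists2 delta : R, 0 < delta &
    forall xs, ergodic_pseudo_orbit f delta xs ->
      exists x, shadowed_in_average_by f eps xs x.

Definition forward_orbit (X : Type) (f : X -> X) (x : X) : set X :=
  range (fun n => iter n f x).

Definition syndetically_recurrent (X : topologicalType) (f : X -> X)
    (x : X) : Prop :=
  forall U : set X, open_nbhs x U ->
    syndetic [set n | (1 <= n)%N /\ U (iter n f x)].

Definition minimal_map (X : topologicalType) (f : X -> X) : Prop :=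
  exists2 x, syndetically_recurrent f x & closure (forward_orbit f x) = setT.

(* Main.v *)
Require Import Defs.
From mathcomp Require Import all_boot all_order all_algebra.
From mathcomp Require Import all_classical all_reals all_analysis.
From mathcomp Require Import zify lra.
Import Order.TTheory GRing.Theory Num.Theory.
Import numFieldNormedType.Exports.
Local Open Scope classical_set_scope.
Local Open Scope ring_scope.

(** Suppose that [f] is minimal. Two consequences of this clash with
    mean ergodic shadowing.

    Rigidity. Minimality and shadowing together make [f] uniformly
    equicontinuous ([shadowing_dense_equicontinuous]). Indeed a point [x0] comes
    back within [d] of itself after some time [n]; closing this piece of orbit
    up gives a periodic [d]-pseudo-orbit, shadowed by the orbit of some [z].
    That orbit is dense, so every point of [X] stays close, for ever, to the
    periodic pseudo-orbit started at one of its [n] phases. Points with the same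
    phase thus stay close to each other, and [n] closed sets of phases cover
    [X], so that nearby points are related through a common phase.

    Drift. Every orbit of a minimal map is dense
    ([minimal_orbit_dense]); as [X] has two points, [f] has no fixed point, and
    by compactness it moves every point by at least some [c > 0]
    ([compact_displacement_ge]).

    Consider the sequence that runs along the orbit of [x0] on the dyadic blocks
    [2^k, 2^k.+1) with [k] even, and along the orbit of [f x0], one step ahead,
    on those with [k] odd. It jumps only at the ends of the blocks, a set of
    density zero, so it is a [delta]-ergodic pseudo-orbit for every [delta > 0].
    If the orbit of [y] is ever close to it in an even block, then by rigidity
    it follows the orbit of [x0] for ever and by drift it is far from the
    sequence in all later odd blocks; otherwise it is far from the sequence in
    all even blocks. In both cases it is far on a whole block infinitely often,
    and since a dyadic block makes up half of the times before its end, the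
    average error does not become small ([limn_esup_average_ge]). *)

Set Implicit Arguments.
Unset Strict Implicit.

(** * Minimality, equicontinuity and displacement *)

Lemma iter_continuous (T : topologicalType) (f : T -> T) (n : nat) :
  continuous f -> continuous (iter n f).
Proof.
move=> hf; elim: n => [|n IH] x; first exact: cvg_id.
exact: (continuous_comp (IH x) (hf _)).
Qed.

Lemma near_mdist_iter (R : realType) (X : metricType R) (f : X -> X)
    (n : nat) (z : X) (e : R) :
  continuous f -> 0 < e ->
  \forall w \near z, mdist (iter n f z) (iter n f w) < e.
Proof.
move=> hf e0; apply: metricType_numDomainType.cvgr_dist_lt => //.
exact: iter_continuous.
Qed.

Lemma near_mdist (R : realType) (X : metricType R) (z : X) (e : R) :
  0 < e -> \forall w \near z, mdist z w < e.
Proof.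
by move=> e0; apply: metricType_numDomainType.cvgr_dist_lt => //; exact: cvg_id.
Qed.

Lemma nbhs_mdist_lt (R : realType) (X : metricType R) (x : X) (U : set X) :
  nbhs x U -> exists2 e : R, 0 < e & forall y, mdist x y < e -> U y.
Proof. by move/metricType_numDomainType.nbhs_mdistP => [e e0 eU]; exists e. Qed.

Lemma closure_orbit_near (T : topologicalType) (f : T -> T) (z w : T)
    (B : set T) :
  closure (forward_orbit f z) w -> nbhs w B -> exists n, B (iter n f z).
Proof. by move=> cl /cl [_ [[n _ <-] Bn]]; exists n. Qed.

(** The orbit of [x0] comes so near [z] that it stays near the orbit of [z]
    longer than the gap between two returns to [x0]; hence the orbit of [z]
    visits every neighbourhood of [x0], and then follows the dense orbit of
    [x0] to any other place. *)
Lemma minimal_orbit_dense (R : realType) (X : metricType R) (f : X -> X)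
    (z : X) :
  continuous f -> minimal_map f -> closure (forward_orbit f z) = setT.
Proof.
move=> hf [x0 rec dense].
have dense0 w : closure (forward_orbit f x0) w by rewrite dense.
have visit e : 0 < e -> exists m, mdist (iter m f z) x0 < e.
  move=> e0; have e20 : 0 < e / 2 by rewrite divr_gt0.
  have [N hN] := rec _ (open_nbhs_ball x0 (PosNum e20)).
  have nearz : \forall w \near z, forall j : 'I_N.+1,
      mdist (iter j f z) (iter j f w) < e / 2.
    by apply: filter_forall => j; exact: near_mdist_iter.
  have [n hn] := closure_orbit_near (dense0 z) nearz.
  have [k [_ /interior_subset]] := hN n.
  rewrite ballEmdist /= => xk /andP[nk knN].
  exists (k - n)%N; rewrite (splitr e).
  have kN : (k - n < N.+1)%N by rewrite ltnS leq_subLR.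
  have := hn (Ordinal kN); rewrite /= -iterD subnK // => zk.
  apply: le_lt_trans (metric_triangle _ (iter k f x0) _) _.
  by rewrite ltrD // metric_sym.
apply/seteqP; split=> // w _ B Bw.
have [n hn] := closure_orbit_near (dense0 w) (nbhs_interior Bw).
have [e e0 eB] := nbhs_mdist_lt (@iter_continuous _ f n hf x0 _ hn).
have [m zm] := visit e e0.
exists (iter n f (iter m f z)); split.
  by exists (n + m)%N; rewrite // iterD.
by apply: eB; rewrite metric_sym.
Qed.

(** [W i] below is the set of points that follow the periodic pseudo-orbit from
    phase [i]. The sets [W i] cover [X] and are closed, so near [w] one only
    meets those that contain [w] itself; two points near [w] are then compared
    via [w], at a cost of two shadowing errors to reach [w] and two to
    leave it. *)
Lemma shadowing_dense_equicontinuous (R : realType) (X : metricType R)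
    (f : X -> X) (e : R) :
  compact [set: X] -> continuous f -> has_shadowing f ->
  (forall z, closure (forward_orbit f z) = setT) -> 0 < e ->
  exists2 d : R, 0 < d & forall w w', mdist w w' < d ->
    forall j, mdist (iter j f w) (iter j f w') < e.
Proof.
move=> hX hf hsh dense e0.
have [[x0 _]|X0] := pselect ([set: X] !=set0); last first.
  by exists 1 => // w; exfalso; apply: X0; exists w.
(* Four shadowing errors have to add up to less than [e]. *)
have e50 : 0 < e / 5 by rewrite divr_gt0.
have [d d0 hd] := hsh _ e50.
have [n0 hn0] : exists n0, mdist x0 (iter n0 f (f x0)) < d.
  apply: (@closure_orbit_near _ f (f x0) x0) (near_mdist x0 d0).
  by rewrite dense.
pose n := n0.+1.
pose xs i := iter (i %% n)%N f x0.
have pxs : pseudo_orbit f d xs.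
  move=> i; rewrite /xs modnS -iterS.
  case: ifPn => [dv|_]; last by rewrite mdistxx.
  have -> : ((i %% n).+1 = n)%N.
    move: dv; rewrite -addn1 /dvdn -modnDml addn1 => /eqP dv.
    have := ltn_pmod i (isT : (0 < n)%N); rewrite leq_eqVlt => /orP[/eqP//|lt].
    by rewrite modn_small in dv.
  by rewrite metric_sym /n iterSr.
have [z hz] := hd _ pxs.
pose W (i : nat) : set X :=
  [set w | forall j, mdist (iter j f w) (xs (i + j)%N) <= e / 5].
have Wz m : W (m %% n)%N (iter m f z).
  move=> j; rewrite -iterD addnC; apply: ltW; have := hz (m + j)%N.
  by rewrite /xs modnDml.
(* The closedness of all the sets [W i], in a form that serves twice: to pass
   from the dense orbit of [z] to all of [X], and to compare nearby points. *)
have W_near w : \forall w' \near w, forall i : 'I_n, W i w' -> W i w.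
  apply: filter_forall => i.
  have [Ww|/existsNP[j /negP]] := pselect (W i w); first by apply: nearW.
  rewrite -ltNge -subr_gt0 => far.
  apply: filterS (near_mdist_iter j w hf far) => w' ww' /(_ j) close.
  have := metric_triangle (iter j f w) (iter j f w') (xs (i + j)%N); lra.
have Wcover w : exists i : 'I_n, W i w.
  have [m hm] : exists m, forall i : 'I_n, W i (iter m f z) -> W i w.
    by apply: (@closure_orbit_near _ f z w) (W_near w); rewrite dense.
  have mn : (m %% n < n)%N by rewrite ltn_pmod.
  by exists (Ordinal mn); apply: hm; exact: Wz.
have Wclose i w w' j : W i w -> W i w' ->
    mdist (iter j f w) (iter j f w') <= 2 * (e / 5).
  move=> /(_ j) Wi /(_ j) Wi'.
  have := metric_triangle (iter j f w) (xs (i + j)%N) (iter j f w').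
  rewrite (metric_sym (xs _)); lra.
pose good (d : R) w := forall w', mdist w w' < d ->
    forall j, mdist (iter j f w) (iter j f w') < e.
have : \forall d \near 0^'+, [set: X] `<=` good d.
  move/compact_near_coveringP : hX; apply=> w _.
  have [r r0 hr] := nbhs_mdist_lt (W_near w).
  have r20 : 0 < r / 2 by rewrite divr_gt0.
  exists ([set v | mdist w v < r / 2], [set d | d <= r / 2]).
    by split => /=; [exact: near_mdist | exact: nbhs_right_le].
  move=> [v d'] /= [wv d'r] v' vv' j.
  have [i Wiv] := Wcover v; have [i' Wiv'] := Wcover v'.
  have Wi w1 : mdist w w1 < r -> forall i1 : 'I_n, W i1 w1 -> W i1 w.
    by move=> /hr.
  have wiv : W i w by apply: (Wi v) => //; lra.
  have wiv' : W i' w.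
    apply: (Wi v') => //; have := metric_triangle w v v'; lra.
  have := metric_triangle (iter j f v) (iter j f w) (iter j f v').
  have := Wclose _ _ _ j Wiv wiv; have := Wclose _ _ _ j wiv' Wiv'; lra.
move=> neargood.
near (0 : R)^'+ => r.
have hr : [set: X] `<=` good r by near: r.
by exists r => // w; exact: (hr w I).
Unshelve. all: by end_near. Qed.

Lemma compact_displacement_ge (R : realType) (X : metricType R) (f : X -> X) :
  compact [set: X] -> continuous f -> (forall w, f w <> w) ->
  exists2 c : R, 0 < c & forall w, c <= mdist w (f w).
Proof.
move=> hX hf nofix.
have : \forall c \near 0^'+, [set: X] `<=` [set w | c <= mdist w (f w)].
  move/compact_near_coveringP : hX; apply=> w _.
  have D0 : 0 < mdist w (f w).
    by rewrite mdist_gt0; apply/eqP => fw; apply: (nofix w).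
  have D40 : 0 < mdist w (f w) / 4 by rewrite divr_gt0.
  exists ([set v | mdist w v < mdist w (f w) / 4 /\
                   mdist (f w) (f v) < mdist w (f w) / 4],
          [set c | c <= mdist w (f w) / 2]).
    split => /=; last by apply: nbhs_right_le; rewrite divr_gt0.
    apply: filterI; first exact: near_mdist.
    exact: (near_mdist_iter 1 w hf D40).
  move=> [v c] /= [[wv fwv] hc].
  have := metric_triangle w v (f w); have := metric_triangle v (f v) (f w).
  rewrite (metric_sym (f v)); lra.
move=> nearc.
near (0 : R)^'+ => c.
have hc : [set: X] `<=` [set w | c <= mdist w (f w)] by near: c.
by exists c => // w; exact: (hc w I).
Unshelve. all: by end_near. Qed.

(** * The ends of the dyadic blocks *)

Lemma trunc_log2S_neq (i : nat) :
  trunc_log 2 i.+1 != trunc_log 2 i -> i.+1 = (2 ^ trunc_log 2 i.+1)%N.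
Proof.
move=> neq; apply/eqP; rewrite eqn_leq trunc_logP // andbT leqNgt.
apply: contra neq => lt; rewrite eqn_leq (leq_trunc_log 2 (leqnSn i)) andbT.
by apply: trunc_log_max.
Qed.

(** Different jumps end blocks of different exponents, and only the exponents up
    to that of [n] occur. *)
Lemma card_trunc_log2_jump (n : nat) :
  (#|[pred i : 'I_n | trunc_log 2 i.+1 != trunc_log 2 i]|
     <= (trunc_log 2 n).+1)%N.
Proof.
pose g (i : 'I_n) : 'I_(trunc_log 2 n).+1 := inord (trunc_log 2 i.+1).
have gE i : g i = trunc_log 2 i.+1 :> nat.
  by rewrite /g inordK // ltnS leq_trunc_log.
have ginj : {in [pred i : 'I_n | trunc_log 2 i.+1 != trunc_log 2 i] &,
    injective g}.
  move=> i j; rewrite !inE => /trunc_log2S_neq hi /trunc_log2S_neq hj gij.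
  by apply/val_inj/succn_inj; rewrite hi hj -!gE gij.
rewrite -(card_in_image ginj) -[leqRHS]card_ord; exact: max_card.
Qed.

(** A square root bound on the number of jumps is crude but enough for density
    zero. *)
Lemma sqr_trunc_log2S_le (n : nat) :
  (0 < n)%N -> ((trunc_log 2 n).+1 ^ 2 <= 4 * n)%N.
Proof.
move=> n0.
have sqr_le k : (k.+1 ^ 2 <= 4 * 2 ^ k)%N.
  elim: k => [//|k IH]; case: (leqP k 1) => [|k1].
    by case: k {IH} => [|[]].
  rewrite (expnS 2 k); move: (2 ^ k)%N IH => p; rewrite !expnS !expn0; nia.
by apply: leq_trans (sqr_le _) _; rewrite leq_mul2l /= trunc_logP.
Qed.

Lemma density_zero_trunc_log2_jump (R : realType) (E : set nat) :
  (forall i, E i -> trunc_log 2 i.+1 != trunc_log 2 i) -> density_zero R E.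
Proof.
move=> hE; apply/cvgrPdist_lt => e e0.
near=> n.
have n0 : (0 < n)%N by near: n; exact: nbhs_infty_gt.
have n0R : 0 < n%:R :> R by rewrite ltr0n.
have large : 4 / e ^+ 2 < n%:R by near: n; exact: nbhs_infty_gtr.
rewrite sub0r normrN ger0_norm ?divr_ge0 // ltr_pdivrMr //.
set c := #|_|.
have c2 : (c ^ 2 <= 4 * n)%N.
  apply: leq_trans (sqr_trunc_log2S_le n0).
  rewrite leq_exp2r //; apply: leq_trans (card_trunc_log2_jump n).
  by apply: subset_leq_card; apply/fintype.subsetP => i; rewrite !inE => /hE.
have {}c2 : (c%:R : R) ^+ 2 <= 4 * n%:R by rewrite -natrX -natrM ler_nat.
rewrite -(ltr_pXn2r (ltn0Sn 1)) ?nnegrE ?mulr_ge0 // ?(ltW e0) //.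
apply: le_lt_trans c2 _; rewrite exprMn (expr2 n%:R) mulrA ltr_pM2r //.
by move: large; rewrite ltr_pdivrMr ?exprn_gt0 // mulrC.
Unshelve. all: by end_near. Qed.

(** * Averages over dyadic blocks *)

Lemma limn_esup_lt_near (R : realType) (u : nat -> \bar R) (l : \bar R) :
  (limn_esup u < l)%E -> \forall n \near \oo, (u n < l)%E.
Proof.
move=> /ereal_inf_lt[_ [V Voo <-]] Vl; apply: filterS Voo => n Vn.
by apply: le_lt_trans Vl; apply: ereal_sup_ubound; exists n.
Qed.

(** At the end of the block of exponent [k] that block makes up half of the
    elapsed time, so errors of at least [c] on it alone keep the average at
    [c / 2] or above. *)
Lemma limn_esup_average_ge (R : realType) (D : nat -> R) (c : R) :
  (forall i, 0 <= D i) ->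
  (forall K, exists2 k, (K <= k)%N & forall i, trunc_log 2 i = k -> c <= D i) ->
  ((c / 2)%:E <= limn_esup (fun n => (n%:R^-1 * \sum_(i < n) D i)%:E))%E.
Proof.
move=> D0 blocks; rewrite leNgt; apply/negP => /limn_esup_lt_near[K _ hK].
have [k Kk hk] := blocks K.
have lek : (K <= 2 ^ k.+1)%N.
  apply: leq_trans Kk _; rewrite ltnW // (leq_trans (ltnSn k)) //.
  by rewrite ltnW // ltn_expl.
have := hK _ lek; rewrite /= lte_fin ltNge => /negP; apply.
rewrite ler_pdivlMl ?ltr0n ?expn_gt0 //.
rewrite -(big_mkord xpredT D) (@big_cat_nat _ _ _ (2 ^ k)%N) //=; last first.
  by rewrite leq_exp2l.
rewrite -[leLHS]add0r lerD ?sumr_ge0 //.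
have -> : (2 ^ k.+1)%:R * (c / 2) = \sum_(2 ^ k <= i < 2 ^ k.+1) c.
  rewrite sumr_const_nat expnS mul2n -addnn addnK natrD -[RHS]mulr_natr; lra.
apply: ler_sum_nat => i hi; apply: hk; exact: trunc_log_eq.
Qed.

Theorem theorem3p19 (R : realType) (X : metricType R) (f : X -> X)
    (hX : compact [set: X]) (hX2 : exists x y : X, x <> y)
    (hf : continuous f) (hsh : has_shadowing f)
    (hmes : has_mean_ergodic_shadowing f) :
  ~ minimal_map f.
Proof.
move=> /minimal_orbit_dense - /(_ _ hf) dense.
have nofix w : f w <> w.
  move=> fw; have fixw n : iter n f w = w by elim: n => //= n ->.
  suff all_w v : v = w.
    by case: hX2 => x [y]; apply; rewrite (all_w x) (all_w y).
  apply: contrapT => /eqP; rewrite -mdist_gt0 => vw.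
  have [n] : exists n, mdist v (iter n f w) < mdist v w.
    by apply: (@closure_orbit_near _ f w v) (near_mdist v vw); rewrite dense.
  by rewrite fixw ltxx.
have [x0 _] := hX2.
have [c c0 hc] := compact_displacement_ge hX hf nofix.
have c20 : 0 < c / 2 by rewrite divr_gt0.
have [d d0 hd] := shadowing_dense_equicontinuous hX hf hsh dense c20.
pose m := Num.min d (c / 2).
have m20 : 0 < m / 2 by rewrite divr_gt0 // lt_min d0.
(* The parity of the block decides whether the sequence is one step ahead. *)
pose xs i := iter (odd (trunc_log 2 i) + i)%N f x0.
have [delta delta0 hdelta] := hmes _ m20.
have [|y] := hdelta xs.
  apply: density_zero_trunc_log2_jump => i /=; apply: contraTneq => eqlog.
  by rewrite /xs eqlog -iterS addnS mdistxx -ltNge.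
apply/negP; rewrite -leNgt.
apply: (@limn_esup_average_ge _ (fun i => mdist (iter i f y) (xs i))) => [i|K].
  exact: mdist_ge0.
have [[i [eveni close]]|far] := pselect (exists i,
    ~~ odd (trunc_log 2 i) /\ mdist (iter i f y) (xs i) < d).
(* Once close in an even block, [y] stays within [c / 2] of the orbit of [x0],
   hence at least [c / 2] away from the shifted orbit used in odd blocks. *)
- exists (maxn K (trunc_log 2 i)).*2.+1.
    by rewrite -addnn; have := leq_maxl K (trunc_log 2 i); lia.
  move=> j logj.
  have ij : (i <= j)%N.
    rewrite leqNgt; apply/negP => /ltnW/(leq_trunc_log 2).
    by rewrite logj -addnn; have := leq_maxr K (trunc_log 2 i); lia.
  have closej : mdist (iter j f y) (iter j f x0) < c / 2.
    move: close; rewrite /xs (negbTE eveni) add0n => /hd/(_ (j - i)%N).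
    by rewrite -!iterD subnK.
  have := hc (iter j f x0); rewrite /xs logj /= odd_double /= => hcj.
  have := metric_triangle (iter j f x0) (iter j f y) (f (iter j f x0)).
  rewrite (metric_sym _ (iter j f y)) ge_min add0n => tri.
  by apply/orP; right; lra.
- exists K.*2; first by rewrite -addnn leq_addr.
  move=> j logj; rewrite ge_min leNgt; apply/orP; left; apply/negP => close.
  by apply: far; exists j; rewrite logj odd_double.
Qed.
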